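(* Let $(X,d)$ be a Heine-Borel metric space, let $x_0\in X$ be a fixed (arbitrary) point, and let $0<a<b$, $r>0$ and $c>0$ be real constants. Then the set $\mathbb{P}_{a,b}^{r,c}(X)$ is a compact subset of $\mathbb{P}(X)$. Hence, the set $\mathbb{P}_{a,b}^{r}(X)$ is a $\sigma$-compact subset of $\mathbb{P}(X)$.
   Context: A metric space $(X,d)$ is called a Heine-Borel (or proper) metric space if its closed and bounded subsets are compact. $\mathbb{P}(X)$ denotes the space of probability measures on the Borel $\sigma$-algebra of $X$, endowed with the topology of weak convergence, that is, the coarsest topology making $\mu \mapsto \int_X v(y)\,\mu(dy)$ continuous for every bounded continuous function $v:X\to\mathbb{R}$. A subset is $\sigma$-compact if it is a countable union of compact subsets. For the fixed point $x_0\in X$ define $$\mathbb{P}_{a,b}(X):=\Big\{\mu\in\mathbb{P}(X): a\leq\int_X d(x,x_0)\,\mu(dx)\leq b\Big\},$$ $$\mathbb{P}_{a,b}^{r,c}(X):=\Big\{\mu\in\mathbb{P}_{a,b}(X): \int_X d(x,x_0)^{1+r}\,\mu(dx)\leq c\Big\},$$ $$\mathbb{P}_{a,b}^{r}(X):=\Big\{\mu\in\mathbb{P}_{a,b}(X): \int_X d(x,x_0)^{1+r}\,\mu(dx)<\infty\Big\}.$$ *)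

(* Defs.v *)
From HB Require Import structures.
From mathcomp Require Import all_boot all_order all_algebra.
From mathcomp Require Import all_classical all_reals all_analysis.
Import Order.TTheory GRing.Theory Num.Theory.
Import numFieldNormedType.Exports.

Set Implicit Arguments.
Unset Strict Implicit.
Unset Printing Implicit Defensive.

Local Open Scope classical_set_scope.
Local Open Scope ring_scope.

(* [g_sigma_algebraType] expects a pointed carrier.  The distinguished point
   only records that the space is nonempty; the base point [x0] of the moment
   conditions below is a separate, arbitrary argument. *)
#[short(type="pmetricType")]
HB.structure Definition PointedMetric (K : numDomainType) :=
  { M of Metric K M & Pointed M }.

Definition metric_bounded (R : realType) (X : metricType R) (A : set X) : Prop :=
  exists M : R, forall x y : X, A x -> A y -> mdist x y <= M.

Definition heine_borel_space (R : realType) (X : metricType R) : Prop :=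
  forall A : set X, closed A -> metric_bounded A -> compact A.

Definition sigma_compact (T : topologicalType) (A : set T) : Prop :=
  exists2 K : nat -> set T, (forall n, compact (K n)) & A = \bigcup_n K n.

Definition borelType (R : realType) (X : pmetricType R) :=
  g_sigma_algebraType (@open X).

Definition bounded_continuous (R : realType) (X : pmetricType R) : Type :=
  {v : X -> R | continuous v /\ bounded_fun v}.

(* A library measure is a function on all subsets, with unconstrained values off
   the sigma-algebra, so distinct elements of this type may be the same Borel
   measure.  Such elements are topologically indistinguishable and have the same
   moments, so passing to the quotient changes neither compactness nor
   sigma-compactness of the sets of measures considered here. *)
Definition Pspace (R : realType) (X : pmetricType R) : Type :=
  probability (borelType X) R.

Definition weak_eval (R : realType) (X : pmetricType R)
    (v : bounded_continuous X) (mu : probability (borelType X) R) : R :=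
  \int[mu]_y (sval v y).

(* The coarsest topology making every [weak_eval v] continuous. *)
HB.instance Definition _ (R : realType) (X : pmetricType R) :=
  Topological.copy (Pspace X) (sup_topology (fun v : bounded_continuous X =>
    Topological.class (initial_topology (weak_eval v)))).

(* The moments are integrals of nonnegative functions with values in
   [0, +oo]. *)
Definition moment (R : realType) (X : pmetricType R) (x0 : X) (p : R)
    (mu : probability (borelType X) R) : \bar R :=
  (\int[mu]_x ((mdist (x : X) x0) `^ p)%:E)%E.

Definition Pab (R : realType) (X : pmetricType R) (x0 : X) (a b : R) :
    set (Pspace X) :=
  [set mu : probability (borelType X) R |
    (a%:E <= \int[mu]_x (mdist (x : X) x0)%:E <= b%:E)%E].

Definition Pab_rc (R : realType) (X : pmetricType R) (x0 : X) (a b r c : R) :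
    set (Pspace X) :=
  [set mu | Pab x0 a b mu /\ (moment x0 (1 + r) mu <= c%:E)%E].

Definition Pab_r (R : realType) (X : pmetricType R) (x0 : X) (a b r : R) :
    set (Pspace X) :=
  [set mu | Pab x0 a b mu /\ (moment x0 (1 + r) mu < +oo)%E].

(* Main.v *)
Require Import Defs.
From HB Require Import structures.
From mathcomp Require Import all_boot all_order all_algebra.
From mathcomp Require Import all_classical all_reals all_analysis.
From mathcomp Require Import measurable_realfun ring lra.
Import Order.TTheory GRing.Theory Num.Theory.
Import numFieldNormedType.Exports.
Local Open Scope classical_set_scope.
Local Open Scope ring_scope.

(* A measure on the set with moment bounds b and c puts at most b/M of its mass
   outside the closed ball of radius M, which is compact.  Along an ultrafilter
   of such measures the integral of every bounded continuous v converges; by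
   uniform tightness and Dini's theorem the limit functional L has the Daniell
   property (L h_n -> 0 when h_n decreases pointwise to 0), hence it is
   integration against a Borel probability nu, obtained from the outer measure
   inf { tau G : A included in G open } with tau G = sup { L f : 0 <= f <= 1_G }.
   So the ultrafilter converges weakly to nu.  The upper moment bounds pass to
   nu by truncation and monotone convergence; the lower bound does because
   d - min(d, t) <= t^-r d^(1+r) makes d uniformly integrable. *)

Set Implicit Arguments.
Unset Strict Implicit.
Unset Printing Implicit Defensive.

(** * Bounded continuous functions and bumps *)

Section bounded_continuous_functions.
Context {R : realType} {X : pmetricType R}.
Implicit Types (f g v : X -> R) (G : set X) (n : nat).

(** A bound valid at every point combines more easily than the filter form in [bounded_fun];
    [bcontP] relates the two. *)
Definition bcont v := continuous v /\ exists M : R, forall x, `|v x| <= M.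

Lemma bcontP v : bcont v <-> continuous v /\ bounded_fun v.
Proof.
split=> -[cv bv]; split=> //.
  case: bv => M vM; exists M; split; first exact: num_real.
  by move=> N MN x _; exact: le_trans (vM x) (ltW MN).
(* [bounded_fun] grants only the bounds strictly above [M]. *)
case: bv => M [Mr vM]; exists (M + 1) => x.
by apply: vM => //; rewrite ltrDl.
Qed.

Lemma bcont_cst (r : R) : bcont (fun=> r).
Proof. by split; [move=> x; exact: cvg_cst | exists `|r|]. Qed.

Lemma bcontD f g : bcont f -> bcont g -> bcont (fun x => f x + g x).
Proof.
move=> [cf [M fM]] [cg [N gN]]; split.
  by move=> x; apply: cvgD; [exact: cf|exact: cg].
by exists (M + N) => x; rewrite (le_trans (ler_normD _ _))// lerD.
Qed.

Lemma bcontZ (r : R) f : bcont f -> bcont (fun x => r * f x).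
Proof.
move=> [cf [M fM]]; split.
  by move=> x; apply: cvgM; [exact: cvg_cst|exact: cf].
by exists (`|r| * M) => x; rewrite normrM ler_wpM2l.
Qed.

Lemma bcontB f g : bcont f -> bcont g -> bcont (fun x => f x - g x).
Proof.
move=> bf bg; rewrite (_ : (fun _ => _) = (fun x => f x + (-1) * g x)).
  by apply: bcontD => //; exact: bcontZ.
by apply/funext => x; rewrite mulN1r.
Qed.

Lemma bcont_sum n (f : nat -> X -> R) : (forall i, bcont (f i)) ->
  bcont (fun x => \sum_(i < n) f i x).
Proof.
move=> bf; elim: n => [|n IH].
  rewrite (_ : (fun _ => _) = fun=> 0); first exact: bcont_cst.
  by apply/funext => x; rewrite big_ord0.
rewrite (_ : (fun _ => _) = (fun x => (\sum_(i < n) f i x) + f n x)).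
  exact: bcontD.
by apply/funext => x; rewrite big_ord_recr.
Qed.

Lemma bcont_min f g : bcont f -> bcont g -> bcont (fun x => Num.min (f x) (g x)).
Proof.
move=> [cf [M fM]] [cg [N gN]]; split.
  by move=> x; apply: (@continuous_min R X f g x); [exact: cf|exact: cg].
exists (M + N) => x; rewrite /Num.min; case: ifP => _.
  by rewrite (le_trans (fM x))// lerDl (le_trans _ (gN x)).
by rewrite (le_trans (gN x))// lerDr (le_trans _ (fM x)).
Qed.

Lemma bcont_max f g : bcont f -> bcont g -> bcont (fun x => Num.max (f x) (g x)).
Proof.
move=> [cf [M fM]] [cg [N gN]]; split.
  by move=> x; apply: (@continuous_max R X f g x); [exact: cf|exact: cg].
exists (M + N) => x; rewrite /Num.max; case: ifP => _.
  by rewrite (le_trans (gN x))// lerDr (le_trans _ (fM x)).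
by rewrite (le_trans (fM x))// lerDl (le_trans _ (gN x)).
Qed.

Lemma bcont_unit f : continuous f -> (forall x, 0 <= f x <= 1) -> bcont f.
Proof.
move=> cf f01; split=> //; exists 1 => x.
by have /andP[f0 f1] := f01 x; rewrite ger0_norm.
Qed.

Lemma lipschitz_cont (k : R) f :
  (forall x y, f x - f y <= k * mdist x y) -> continuous f.
Proof.
move=> fk x; apply/cvgrPdist_lt => e e0.
(* [k] may be zero or negative, so a positive constant replaces it before dividing. *)
have k0 : 0 < `|k| + 1 by rewrite ltr_wpDl.
apply/(@metricType_numDomainType.nbhs_mdistP R X).
exists (e / (`|k| + 1)); first by rewrite /= divr_gt0.
move=> y /= xy; rewrite ltr_pdivlMr// in xy.
have le_k u w : f u - f w <= (`|k| + 1) * mdist u w.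
  rewrite (le_trans (fk u w))// ler_wpM2r ?mdist_ge0//.
  by rewrite (le_trans (ler_norm k))// lerDl.
rewrite ltr_norml; have := le_k x y; have := le_k y x.
rewrite (metric_sym y x); nra.
Qed.

Lemma continuous_mdist (x0 : X) : continuous (fun x => mdist x x0).
Proof.
apply: (@lipschitz_cont 1) => x y.
by rewrite mul1r lerBlDr metric_triangle.
Qed.

(** This is min(1, n dist(x, X \ G)), a Lipschitz minorant of the indicator of [G]; the element 1
    also keeps the set nonempty when [G] is the whole space. *)
Definition bump G n x : R := inf ([set 1] `|` [set n%:R * mdist x y | y in ~` G]).

Let bump_lb G n x : has_lbound ([set 1] `|` [set n%:R * mdist x y | y in ~` G]).
Proof. by exists 0 => _ [->|[y _ <-]]//; rewrite mulr_ge0 ?mdist_ge0. Qed.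

Lemma bump_ge G n x z : z <= 1 -> (forall y, ~ G y -> z <= n%:R * mdist x y) ->
  z <= bump G n x.
Proof.
move=> z1 zy; apply: lb_le_inf; first by exists 1; left.
by move=> _ [->|[y Gy <-]] //; exact: zy.
Qed.

Lemma bump_le1 G n x : bump G n x <= 1.
Proof. by apply: ge_inf; [exact: bump_lb | left]. Qed.

Lemma bump_le G n x y : ~ G y -> bump G n x <= n%:R * mdist x y.
Proof. by move=> Gy; apply: ge_inf; [exact: bump_lb | right; exists y]. Qed.

Lemma bump_ge0 G n x : 0 <= bump G n x.
Proof. by apply: bump_ge => // y _; rewrite mulr_ge0 ?mdist_ge0. Qed.

Lemma bump_off G n x : ~ G x -> bump G n x = 0.
Proof.
move=> Gx; apply/eqP; rewrite eq_le bump_ge0 andbT.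
by rewrite (le_trans (bump_le n x Gx))// mdistxx mulr0.
Qed.

Lemma bump_cont G n : continuous (bump G n).
Proof.
apply: (@lipschitz_cont n%:R) => x x'; rewrite lerBlDr -lerBlDl.
apply: bump_ge => [|y Gy].
  by rewrite lerBlDl (le_trans (bump_le1 _ _ _))// lerDr mulr_ge0 ?mdist_ge0.
rewrite lerBlDl -mulrDr (le_trans (bump_le n x Gy))// ler_wpM2l//.
exact: metric_triangle.
Qed.

Lemma bump_bcont G n : bcont (bump G n).
Proof.
by apply: bcont_unit => [|x]; [exact: bump_cont|rewrite bump_ge0 bump_le1].
Qed.

Lemma bump_homo G m n x : (m <= n)%N -> bump G m x <= bump G n x.
Proof.
move=> mn; apply: bump_ge => [|y Gy]; first exact: bump_le1.
by rewrite (le_trans (bump_le m x Gy))// ler_wpM2r ?mdist_ge0 ?ler_nat.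
Qed.

(** The value 1 is attained, not only approached: if the ball of radius e about [x] lies in [G],
    then n >= 1/e gives n d(x, y) >= 1 for all y outside [G]. *)
Lemma bump_near1 G x : open G -> G x -> \forall n \near \oo, bump G n x = 1.
Proof.
move=> oG Gx.
have : nbhs x G by exact: open_nbhs_nbhs.
rewrite -metricType_numDomainType.filter_from_mdist_nbhs => -[e /= e0 eG].
near=> n; apply/eqP; rewrite eq_le bump_le1 bump_ge// => y Gy.
have ey : e <= mdist x y by rewrite leNgt; apply/negP => /eG.
have ne : e^-1 <= n%:R by near: n; exact: nbhs_infty_ger.
by rewrite (le_trans _ (ler_pM _ _ ne ey)) ?mulVf ?gt_eqF ?invr_ge0 ?(ltW e0).
Unshelve. all: by end_near. Qed.

End bounded_continuous_functions.
Arguments bcont {R X} v.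

(** * The Daniell representation theorem *)

Record daniell_functional (R : realType) (X : pmetricType R) := DaniellFunctional {
  daniell_fun :> (X -> R) -> R;
  daniellD : forall f g, bcont f -> bcont g ->
    daniell_fun (fun x => f x + g x) = daniell_fun f + daniell_fun g;
  daniellZ : forall r f, bcont f ->
    daniell_fun (fun x => r * f x) = r * daniell_fun f;
  daniell_ge0 : forall f, bcont f -> (forall x, 0 <= f x) -> 0 <= daniell_fun f;
  daniell1 : daniell_fun (fun=> 1) = 1;
  daniell_cvg0 : forall h : nat -> X -> R, (forall n, bcont (h n)) ->
    (forall x m n, (m <= n)%N -> h n x <= h m x) ->
    (forall x, h n x @[n --> \oo] --> 0) ->
    daniell_fun (h n) @[n --> \oo] --> 0 }.

(** * The outer measure of a Daniell functional *)

Section daniell_outer_measure.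
Context {R : realType} {X : pmetricType R} (L : daniell_functional X).
Implicit Types (f g : X -> R) (A G : set X).

Lemma daniellB f g : bcont f -> bcont g ->
  L (fun x => f x - g x) = L f - L g.
Proof.
move=> bf bg; rewrite (_ : (fun _ => _) = (fun x => f x + (-1) * g x)).
  by rewrite daniellD ?daniellZ ?mulN1r//; exact: bcontZ.
by apply/funext => x; rewrite mulN1r.
Qed.

Lemma daniell_le f g : bcont f -> bcont g -> (forall x, f x <= g x) -> L f <= L g.
Proof.
move=> bf bg fg; rewrite -subr_ge0 -daniellB//.
by apply: daniell_ge0 => [|x]; [exact: bcontB|rewrite subr_ge0].
Qed.

Lemma daniell_cst (r : R) : L (fun=> r) = r.
Proof.
rewrite (_ : (fun _ => r) = (fun x => r * 1)); last by apply/funext => x; rewrite mulr1.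
by rewrite daniellZ ?daniell1 ?mulr1//; exact: bcont_cst.
Qed.

Lemma daniell_sum n (f : nat -> X -> R) : (forall i, bcont (f i)) ->
  L (fun x => \sum_(i < n) f i x) = \sum_(i < n) L (f i).
Proof.
move=> bf; elim: n => [|n IH].
  rewrite (_ : (fun _ => _) = fun=> 0) ?daniell_cst ?big_ord0//.
  by apply/funext => x; rewrite big_ord0.
rewrite (_ : (fun _ => _) = (fun x => (\sum_(i < n) f i x) + f n x)).
  by rewrite daniellD ?IH ?big_ord_recr//; exact: bcont_sum.
by apply/funext => x; rewrite big_ord_recr.
Qed.

Definition subordinate G f :=
  [/\ bcont f, forall x, 0 <= f x <= 1 & forall x, ~ G x -> f x = 0].

(** The future measure of an open set, approximated from inside as in the Riesz representation
    theorem. *)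
Definition tau G : \bar R := ereal_sup [set (L f)%:E | f in subordinate G].

Lemma tau_ub G f : subordinate G f -> ((L f)%:E <= tau G)%E.
Proof. by move=> Gf; apply: ereal_sup_ubound; exists f. Qed.

Lemma subordinate0 G : subordinate G (fun=> 0).
Proof. by split => // [|x]; [exact: bcont_cst|rewrite lexx ler01]. Qed.

Lemma tau_ge0 G : (0 <= tau G)%E.
Proof. by have := tau_ub (subordinate0 G); rewrite daniell_cst. Qed.

Lemma tau_le1 G : (tau G <= 1)%E.
Proof.
apply: ge_ereal_sup => _ [f [bf f01 _] <-]; rewrite lee_fin -(daniell1 L).
by apply: daniell_le => // [|x]; [exact: bcont_cst|have /andP[] := f01 x].
Qed.

Lemma tau_fin G : tau G \is a fin_num.
Proof.
by rewrite ge0_fin_numE ?tau_ge0// (le_lt_trans (tau_le1 G))// ltry.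
Qed.

Lemma tau_setT : tau setT = 1%E.
Proof.
apply/eqP; rewrite eq_le tau_le1/= -(daniell1 L) tau_ub//.
by split => [|x|x []//]; [exact: bcont_cst|rewrite ler01 lexx].
Qed.

Lemma tau_set0 : tau set0 = 0%E.
Proof.
apply/eqP; rewrite eq_le tau_ge0 andbT; apply: ge_ereal_sup => _ [f [_ _ f0] <-].
by rewrite (_ : f = fun=> 0) ?daniell_cst//; apply/funext => x; exact: f0.
Qed.

Lemma le_tau A G : A `<=` G -> (tau A <= tau G)%E.
Proof.
move=> AG; apply: ge_ereal_sup => _ [f [bf f01 f0] <-]; apply: tau_ub.
by split => // x Gx; apply: f0 => /AG.
Qed.

Lemma tau_adherent G (e : R) : 0 < e ->
  exists2 f, subordinate G f & (tau G <= (L f + e)%:E)%E.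
Proof.
move=> e0; have [_ [f Gf <-] fe] := ub_ereal_sup_adherent e0 (tau_fin G).
by exists f => //; rewrite EFinD -leeBlDr// ltW.
Qed.

(* The excess of [f] over the sum of the first [n] bumps decreases pointwise to
   [0], so the Daniell property takes the place of a compactness argument. *)
Lemma tau_sigma_subadditive (G : nat -> set X) : (forall i, open (G i)) ->
  (tau (\bigcup_i G i) <= \sum_(i <oo) tau (G i))%E.
Proof.
move=> oG; apply: ge_ereal_sup => _ [f [bf f01 f0] <-].
(* The index [n] is both the number of bumps and their slope, so [s] increases with [n] while each
   bump still reaches 1. *)
pose s n x : R := \sum_(i < n) bump (G i) n x.
pose h n x : R := Num.max 0 (f x - s n x).
have bs n : bcont (s n).
  by apply: (@bcont_sum _ _ n (fun i => bump (G i) n)) => i; exact: bump_bcont.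
have bh n : bcont (h n) by apply: bcont_max; [exact: bcont_cst|exact: bcontB].
have s_homo x m n : (m <= n)%N -> s m x <= s n x.
  move=> mn; rewrite /s -(subnKC mn) big_split_ord/= ler_wpDr//.
    by apply: sumr_ge0 => i _; exact: bump_ge0.
  by apply: ler_sum => i _; apply: bump_homo; rewrite leq_addr.
have Lh : L (h n) @[n --> \oo] --> 0.
  apply: daniell_cvg0 => // [x m n mn|x].
    rewrite /h ge_max le_max lexx/= le_max; apply/orP; right.
    by rewrite lerB// s_homo.
  (* The sequence is eventually 0: off the union [f] vanishes, and at a point of [G i] the bump of
     [G i] alone eventually dominates [f]. *)
  apply: cvg_near_cst.
  have [[i _ Gix]|nGx] := pselect ((\bigcup_i G i) x); last first.
    apply: nearW => n; rewrite /h f0// sub0r; apply/max_idPl.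
    by rewrite oppr_le0; apply: sumr_ge0 => j _; exact: bump_ge0.
  near=> n; rewrite /h; apply/max_idPl; rewrite subr_le0.
  have /andP[_ fx1] := f01 x; apply: le_trans fx1 _.
  have ni : (i < n)%N by near: n; exact: nbhs_infty_gt.
  rewrite /s (bigD1 (Ordinal ni))//=.
  have -> : bump (G i) n x = 1 by near: n; apply: bump_near1.
  by rewrite lerDl; apply: sumr_ge0 => j _; exact: bump_ge0.
apply/lee_addgt0Pr => e e0.
have /cvgrPdist_lt/(_ _ e0)[n _ /(_ n (leqnn n))] := Lh.
rewrite /= sub0r normrN => /(le_lt_trans (ler_norm _)) Lhe.
have Lf : L f <= e + \sum_(i < n) L (bump (G i) n).
  rewrite -(@daniell_sum n (fun i => bump (G i) n)); last by move=> i; exact: bump_bcont.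
  rewrite (le_trans (daniell_le bf (bcontD (bh n) (bs n)) _))//.
    by move=> x; rewrite -lerBlDr le_max lexx orbT.
  by rewrite daniellD// lerD2r ltW.
rewrite addeC (@le_trans _ _ (e + \sum_(i < n) L (bump (G i) n))%:E)//.
rewrite EFinD leeD2l//.
apply: (@le_trans _ _ (\sum_(0 <= i < n) tau (G i))%E).
  rewrite big_mkord -sumEFin; apply: lee_sum => i _; apply: tau_ub.
  split=> [|x|x Gx]; [exact: bump_bcont|by rewrite bump_ge0 bump_le1|exact: bump_off].
by apply: nneseries_lim_ge => k _ _; exact: tau_ge0.
Unshelve. all: by end_near. Qed.

Definition daniell_outer A : \bar R :=
  ereal_inf [set tau G | G in [set G | open G /\ A `<=` G]].

Lemma daniell_outer_lb A G : open G -> A `<=` G -> (daniell_outer A <= tau G)%E.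
Proof. by move=> oG AG; apply: ereal_inf_lbound; exists G. Qed.

Lemma daniell_outer_open G : open G -> daniell_outer G = tau G.
Proof.
move=> oG; apply/eqP; rewrite eq_le daniell_outer_lb//=.
by apply: le_ereal_inf_tmp => _ [H [_ GH] <-]; exact: le_tau.
Qed.

Lemma daniell_outer_ge0 A : (0 <= daniell_outer A)%E.
Proof. by apply: le_ereal_inf_tmp => _ [G _ <-]; exact: tau_ge0. Qed.

Lemma daniell_outer_fin A : daniell_outer A \is a fin_num.
Proof.
rewrite ge0_fin_numE ?daniell_outer_ge0//.
by rewrite (le_lt_trans (daniell_outer_lb openT (@subsetT _ A)))// tau_setT ltry.
Qed.

Lemma daniell_outer_adherent A (e : R) : 0 < e ->
  exists2 G, open G /\ A `<=` G & (tau G <= daniell_outer A + e%:E)%E.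
Proof.
move=> e0; have [_ [G AG <-] Ge] := lb_ereal_inf_adherent e0 (daniell_outer_fin A).
by exists G => //; exact: ltW.
Qed.

Let daniell_outer0 : daniell_outer set0 = 0%E.
Proof. by rewrite daniell_outer_open ?tau_set0//; exact: open0. Qed.

Let le_daniell_outer : {homo daniell_outer : A B / A `<=` B >-> (A <= B)%E}.
Proof.
move=> A B AB; apply: le_ereal_inf_tmp => _ [G [oG BG] <-].
by apply: daniell_outer_lb => //; exact: subset_trans BG.
Qed.

(** Open supersets chosen with errors e / 2^(i+1), of total e, reduce the claim to
    [tau_sigma_subadditive]. *)
Let daniell_outer_sigma_subadditive : sigma_subadditive daniell_outer.
Proof.
move=> F; apply/lee_addgt0Pr => e e0.
have e0' i : 0 < e / (2 ^ i.+1)%:R by rewrite divr_gt0// ltr0n expn_gt0.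
have /choice[G GF] : forall i, exists G, (open G /\ F i `<=` G) /\
    (tau G <= daniell_outer (F i) + (e / (2 ^ i.+1)%:R)%:E)%E.
  by move=> i; have [G] := daniell_outer_adherent (F i) (e0' i); exists G.
apply: le_trans (epsilon_trick xpredT (fun i => daniell_outer_ge0 (F i)) (ltW e0)).
apply: (@le_trans _ _ (\sum_(i <oo) tau (G i))%E).
  apply: (@le_trans _ _ (tau (\bigcup_i G i))).
    apply: daniell_outer_lb; first by apply: bigcup_open => i _; have [[]] := GF i.
    by apply: subset_bigcup => i _; have [[]] := GF i.
  by apply: tau_sigma_subadditive => i; have [[]] := GF i.
apply: lee_nneseries => [i _ _|i _]; first exact: tau_ge0.
by have [] := GF i.
Qed.

HB.instance Definition _ := isOuterMeasure.Build R X daniell_outer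
  daniell_outer0 daniell_outer_ge0 le_daniell_outer daniell_outer_sigma_subadditive.

(* [(f - d)^+] vanishes on the open set [f < d], so adding to it a function
   subordinate to [V] and [f < d] stays below [1]. *)
Lemma open_caratheodory G : open G -> daniell_outer.-caratheodory G.
Proof.
move=> oG; apply: le_caratheodory_measurable => E /=.
apply/lee_addgt0Pr => e e0.
(* Four errors of size [d] add up: the choices of [V], [f] and [g], and the passage from [f] to
   [f']. *)
pose d := e / 4; have d0 : 0 < d by rewrite divr_gt0.
have [V [oV EV] Vd] := daniell_outer_adherent E d0.
have [f [bf f01 f0] fd] := tau_adherent (V `&` G) d0.
pose f' x : R := Num.max 0 (f x - d).
pose W := V `&` [set x | f x < d].
have oW : open W.
  apply: openI => //; rewrite (_ : [set _ | _] = f @^-1` `]-oo, d[).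
    by apply: open_comp => [x _|]; [case: bf|exact: interval_open].
  by apply/seteqP; split=> x /=; rewrite in_itv.
have [g [bg g01 g0] gd] := tau_adherent W d0.
have bf' : bcont f' by apply: bcont_max; [|apply: bcontB => //]; exact: bcont_cst.
have Vfg : subordinate V (fun x => f' x + g x).
  split=> [|x|x Vx]; first exact: bcontD.
    have /andP[f_ge0 f_le1] := f01 x; have /andP[g_ge0 g_le1] := g01 x.
    rewrite /f'; have [fxd|fxd] := ltP (f x) d.
      by rewrite max_l ?add0r ?g_ge0// subr_le0 ltW.
    rewrite g0 => [|[_ /=]]; last by rewrite ltNge fxd.
    by rewrite addr0 max_r ?subr_ge0// fxd/= lerBlDr (le_trans f_le1)// lerDl ltW.
  rewrite g0 => [|[//]]; rewrite /f' f0 => [|[//]].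
  by rewrite addr0 max_l// sub0r oppr_le0 ltW.
have Lf : L f <= L f' + d.
  rewrite -[in leRHS](daniell_cst d) -daniellD//; last exact: bcont_cst.
  apply: daniell_le => //; first by apply: bcontD => //; exact: bcont_cst.
  by move=> x; rewrite -lerBlDr le_max lexx orbT.
have EG : (daniell_outer (E `&` G) <= (L f' + d + d)%:E)%E.
  apply: (@le_trans _ _ (tau (V `&` G))).
    by apply: daniell_outer_lb; [exact: openI|exact: setSI].
  by rewrite (le_trans fd)// lee_fin lerD2r.
(* [W] covers the part of [E] outside [G], since [f] vanishes there. *)
have ENG : (daniell_outer (E `&` ~` G) <= (L g + d)%:E)%E.
  apply: le_trans gd; apply: daniell_outer_lb => // x [Ex Gx]; split; first exact: EV.
  by rewrite /= f0// => -[].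
apply: (le_trans (leeD EG ENG)).
have LV : ((L f' + L g)%:E <= daniell_outer E + d%:E)%E.
  by rewrite -daniellD// (le_trans _ Vd)// tau_ub.
rewrite (_ : (_ + _)%E = ((L f' + L g)%:E + (3 * d)%:E)%E); last first.
  by rewrite -!EFinD; congr EFin; ring.
rewrite (_ : e%:E = (d%:E + (3 * d)%:E)%E); last first.
  by rewrite -!EFinD; congr EFin; rewrite /d; field.
by rewrite addeA leeD2r.
Qed.

(** The Caratheodory sets form a sigma-algebra, and it contains the open sets. *)
Lemma borel_caratheodory (A : set (borelType X)) :
  measurable A -> daniell_outer.-caratheodory A.
Proof.
apply: smallest_sub A; last by move=> G; exact: open_caratheodory.
split=> [|A mA|F mF].
- exact: caratheodory_measurable_set0.
- by rewrite setTD; exact: caratheodory_measurable_setC.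
- exact: caratheodory_measurable_bigcup.
Qed.

(** A copy typed over [borelType X], to carry the probability structure beside the outer measure
    structure of [daniell_outer]. *)
Definition daniell_measure : set (borelType X) -> \bar R := daniell_outer.

Let daniell_measure_sigma_additive : semi_sigma_additive daniell_measure.
Proof.
move=> F mF tF mUF; rewrite /daniell_measure.
apply: caratheodory_measure_sigma_additive => //.
  by move=> i; exact: (borel_caratheodory (mF i)).
exact: (borel_caratheodory mUF).
Qed.

HB.instance Definition _ := isMeasure.Build _ _ _ daniell_measure
  daniell_outer0 daniell_outer_ge0 daniell_measure_sigma_additive.

Let daniell_measure_setT : daniell_measure setT = 1%E.
Proof. by rewrite /daniell_measure daniell_outer_open ?tau_setT//; exact: openT. Qed.

HB.instance Definition _ := Measure_isProbability.Build _ _ _ daniell_measure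
  daniell_measure_setT.

End daniell_outer_measure.

(** * Representation of the functional as an integral *)

Section borel_integration.
Context {R : realType} {X : pmetricType R}.

Lemma measurable_open (G : set (borelType X)) : open (G : set X) -> measurable G.
Proof. by move=> oG; exact: sub_sigma_algebra. Qed.

Lemma continuous_measurable (f : X -> R) :
  continuous f -> measurable_fun [set: borelType X] f.
Proof.
move=> cf; apply: (measurability _ (RGenOInfty.measurableE R)).
move=> _ [_ [a ->] <-]; apply: measurableI => //; apply: measurable_open.
by apply: open_comp => [x _|]; [exact: cf|exact: interval_open].
Qed.

Lemma bcont_integrable (mu : probability (borelType X) R) (f : X -> R) :
  bcont f -> mu.-integrable [set: borelType X] (EFin \o f).
Proof.
move=> bf; have [cf bdf] := (bcontP f).1 bf.
apply: measurable_bounded_integrable => //.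
  by rewrite (le_lt_trans (probability_le1 mu _))// ltry.
exact: continuous_measurable.
Qed.

Lemma Rintegral_probability_cst (mu : probability (borelType X) R) (r : R) :
  \int[mu]_(_ in [set: borelType X]) r = r.
Proof.
rewrite Rintegral_cst// -[RHS]mulr1; congr (_ * _).
exact: (congr1 fine (probability_setT mu)).
Qed.

Variable L : daniell_functional X.
Implicit Types (f : X -> R) (t d : R).
Let nu : probability (borelType X) R := daniell_measure L.

(* Layer cake: [L] of the slice of [f] between heights [t] and [t + d] and its
   integral are compared through [nu] of the superlevel sets of [f]. *)
Let slice (f : X -> R) (t d : R) x := Num.min (f x) (t + d) - Num.min (f x) t.

Let slice_bcont f t d : bcont f -> bcont (slice f t d).
Proof. by move=> bf; apply: bcontB; apply: bcont_min => //; exact: bcont_cst. Qed.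

Let sliceP f t d x : 0 <= d ->
  [/\ 0 <= slice f t d x <= d, f x <= t -> slice f t d x = 0
    & t + d <= f x -> slice f t d x = d].
Proof.
move=> d0; rewrite /slice; case: (leP (f x) t); case: (leP (f x) (t + d)) => *; split.
all: try lra.
Qed.

Let open_above f t : bcont f -> open [set x | t < f x].
Proof.
move=> [cf _]; rewrite (_ : [set _ | _] = f @^-1` `]t, +oo[).
  by apply: open_comp => [x _|]; [exact: cf|exact: interval_open].
by apply/seteqP; split=> x /=; rewrite in_itv/= andbT.
Qed.

(** The slice divided by [d] is subordinate to the open set where f > t. *)
Let daniell_slice_le f t d : bcont f -> 0 < d ->
  L (slice f t d) <= d * fine (nu [set x | t < f x]).
Proof.
move=> bf d0; have bs := slice_bcont t d bf.
rewrite -ler_pdivrMl// -daniellZ// -lee_fin fineK ?fin_num_measure//; last first.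
  exact: measurable_open (open_above t bf).
rewrite [leRHS]daniell_outer_open; last exact: open_above.
apply: tau_ub; split=> [|x|x /= ftx]; first exact: bcontZ.
  have [/andP[s0 sd] _ _] := sliceP f t x (ltW d0).
  by rewrite mulr_ge0 ?invr_ge0 ?(ltW d0)//= ler_pdivrMl// mulr1.
have [_ s0 _] := sliceP f t x (ltW d0).
by rewrite s0 ?mulr0// leNgt; apply/negP.
Qed.

(** The slice equals [d] where f > t + d, so it dominates [d] times the indicator of that set. *)
Let le_integral_slice f t d : bcont f -> 0 < d ->
  d * fine (nu [set x | t + d < f x]) <= \int[nu]_x slice f t d x.
Proof.
move=> bf d0; set G := [set x | _].
have mG : measurable (G : set (borelType X)).
  exact: measurable_open (open_above (t + d) bf).
have bs := slice_bcont t d bf.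
rewrite -lee_fin EFinM fineK ?fin_num_measure// /Rintegral fineK; last first.
  exact/integrable_fin_num/bcont_integrable.
rewrite -[G]setIT -integral_indic// -ge0_integralZl//; last first.
- by rewrite lee_fin ltW.
- exact/measurable_EFinP/measurable_indic.
apply: ge0_le_integral => //.
- by move=> x _; rewrite mule_ge0// lee_fin ltW.
- by apply/measurable_EFinP; apply: measurable_funM => //; exact: measurable_indic.
- by apply/measurable_EFinP; exact: continuous_measurable bs.1.
move=> x _; rewrite lee_fin indicE; have [/andP[s0 _] _ sd] := sliceP f t x (ltW d0).
have [/set_mem Gx|] := boolP (x \in G); last by rewrite mulr0.
by rewrite mulr1 sd// ltW.
Qed.

(** [L] of each slice is at most the integral of the slice one level lower, through the superlevel
    set at their common height. The sum telescopes; the lowest slice has none below it and costs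
    [d]. *)
Let daniell_min_le f d k : bcont f -> (forall x, 0 <= f x) -> 0 < d ->
  L (fun x => Num.min (f x) (k.+1%:R * d)) <=
  d + \int[nu]_x Num.min (f x) (k%:R * d).
Proof.
move=> bf f0 d0.
have bm t : bcont (fun x => Num.min (f x) t) by apply: bcont_min => //; exact: bcont_cst.
have stepS (j : nat) : j%:R * d + d = j.+1%:R * d.
  by rewrite -[in RHS]addn1 natrD mulrDl mul1r.
elim: k => [|k IH].
  rewrite (@le_trans _ _ d)//; last first.
    by rewrite lerDl Rintegral_ge0// => x _; rewrite le_min f0 mul0r lexx.
  rewrite -[leRHS](daniell_cst L); apply: daniell_le => // [|x]; first exact: bcont_cst.
  by rewrite ge_min mul1r lexx orbT.
have := daniell_slice_le (k.+1%:R * d) bf d0.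
have := le_integral_slice (k%:R * d) bf d0.
rewrite stepS.
move=> /[swap] /le_trans /[apply].
rewrite /slice daniellB// RintegralB//; try exact: bcont_integrable.
rewrite !stepS; lra.
Qed.

(** Once k d >= 1, truncating at k d or (k+1) d leaves [f] unchanged, and only the arbitrary error
    [d] remains. *)
Let daniell_le_integral f : bcont f -> (forall x, 0 <= f x <= 1) ->
  L f <= \int[nu]_x f x.
Proof.
move=> bf f01; apply/ler_addgt0Pl => d d0.
have f0 x : 0 <= f x by have /andP[] := f01 x.
pose k := (Num.truncn d^-1).+1.
have kd (j : nat) : (k <= j)%N -> (fun x => Num.min (f x) (j%:R * d)) = f.
  move=> kj; apply/funext => x; apply/min_idPl.
  have /andP[_ fx1] := f01 x; rewrite (le_trans fx1)// -ler_pdivrMr// mul1r.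
  by rewrite (le_trans (ltW (truncnS_gt _)))// ler_nat.
by have := daniell_min_le k bf f0 d0; rewrite (kd k.+1)// (kd k).
Qed.

(** The reverse inequality is the previous one for 1 - f, as both functionals send 1 to 1. *)
Let daniell_integral_unit f : bcont f -> (forall x, 0 <= f x <= 1) ->
  \int[nu]_x f x = L f.
Proof.
move=> bf f01; apply/eqP; rewrite eq_le daniell_le_integral// andbT.
have b1 : bcont (fun _ : X => 1 : R) by exact: bcont_cst.
have /daniell_le_integral := bcontB b1 bf.
rewrite daniellB// RintegralB//; try exact: bcont_integrable.
rewrite daniell1 Rintegral_probability_cst => H.
rewrite -lerN2 -(lerD2l 1); apply: H => x.
by have /andP[f0 f1] := f01 x; rewrite subr_ge0 f1 lerBlDr lerDl.
Qed.

Lemma daniell_integral f : bcont f -> \int[nu]_x f x = L f.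
Proof.
move=> bf; have [cf [M fM]] := bf.
pose N := `|M| + 1; have N0 : 0 < N by rewrite ltr_wpDl.
have fN x : `|f x| <= N.
  by rewrite (le_trans (fM x))// (le_trans (ler_norm _))// lerDl.
(* An affine change of scale brings the values of [f] from [-N, N] into [0, 1]. *)
pose g x := (2 * N)^-1 * (f x + N).
have bN : bcont (fun _ : X => N) by exact: bcont_cst.
have bg : bcont g by apply: bcontZ; exact: bcontD.
have bfN : bcont (fun x => f x + N) by exact: bcontD.
have := daniell_integral_unit bg.
rewrite /g daniellZ// daniellD// daniell_cst RintegralZl//; last exact: bcont_integrable.
rewrite RintegralD//; try exact: bcont_integrable.
rewrite Rintegral_probability_cst => H.
apply: (@addIr _ N); apply: (@mulfI _ (2 * N)^-1).
  by rewrite invr_eq0 gt_eqF// mulr_gt0.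
apply: H => x; have := fN x; rewrite ler_norml => /andP[Nf fN'].
rewrite mulr_ge0 ?invr_ge0 ?mulr_ge0 ?(ltW N0)//=; last by rewrite -lerBlDr sub0r.
by rewrite ler_pdivrMl ?mulr_gt0// mulr1 mulr_natl mulr2n lerD2r.
Qed.

End borel_integration.

(** * Weak limits of tight ultrafilters *)

Section ultrafilter_limits.
Context {R : realType}.

(** Compactness of [-M, M] gives a cluster point, and an ultrafilter converges to its cluster
    points: it contains the preimage of each neighbourhood or of its complement, and the latter is
    excluded. *)
Lemma ultra_bounded_cvg (T : Type) (F : set_system T) (FU : UltraFilter F)
  (g : T -> R) (M : R) : (forall t, `|g t| <= M) -> cvg (g @ F).
Proof.
move=> gM.
have gF : (g @ F) [set` `[- M, M]].
  by apply: nearW => t; rewrite /= in_itv/= -ler_norml.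
have [p [_ clp]] :=
  segment_compact (fmap_proper_filter g ultra_proper) gF.
apply/cvg_ex; exists p => U /= pU.
have [//|FnU] := in_ultra_setVsetC (g @^-1` U) FU.
by have [y [+ Uy]] := clp (~` U) U FnU pU.
Qed.

(** Some h n x is below [e]; continuity extends this to nearby points and monotonicity to later
    indices, and the near-covering form of compactness makes the index uniform. *)
Lemma dini (X : topologicalType) (K : set X) (h : nat -> X -> R) (e : R) :
  compact K -> (forall n, continuous (h n)) ->
  (forall x m n, (m <= n)%N -> h n x <= h m x) ->
  (forall x, h n x @[n --> \oo] --> 0) -> 0 < e ->
  \forall n \near \oo, forall x, K x -> h n x < e.
Proof.
move=> /compact_near_coveringP cK ch hn h0 e0.
apply: (cK nat \oo (fun n x => h n x < e)) => x Kx.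
have /cvgrPdist_lt/(_ _ e0)[n _ /(_ n (leqnn n))] := h0 x.
rewrite /= sub0r normrN => /(le_lt_trans (ler_norm _)) hnx.
have : \forall y \near x, h n y < e.
  by have := ch n x; move/cvgr_lt; apply.
move=> hny; exists ([set y | h n y < e], [set m | (n <= m)%N]) => /=.
  by split=> //; exact: nbhs_infty_ge.
by move=> [y m] /= [hye nm]; rewrite (le_lt_trans (hn y n m nm)).
Qed.

End ultrafilter_limits.

(** * Weak convergence through integrals *)

Section weak_topology.
Context {R : realType} {X : pmetricType R}.
Implicit Types (v : X -> R) (mu nu : probability (borelType X) R).

(** [weak_eval] on bare functions, without the proof of bounded continuity. *)
Definition mean v mu : R := \int[mu]_x v x.

(** Convergence in a supremum of topologies is convergence in each, and each is initial for one
    [weak_eval v]. *)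
Lemma weak_cvg (F : set_system (Pspace X)) (FF : Filter F) (nu : Pspace X) :
  (forall v, bcont v -> mean v @ F --> mean v nu) -> F --> nu.
Proof.
move=> Fv; apply/cvg_sup => -[v bv] A /= [U [[B Bop BU] Unu UA]].
apply: filterS UA _; rewrite -BU.
apply: (Fv v); first exact/bcontP.
by apply: open_nbhs_nbhs; split => //; move: Unu; rewrite -BU.
Qed.

End weak_topology.

(** * Prokhorov's theorem for ultrafilters *)

Section ultrafilter_of_probabilities.
Context {R : realType} {X : pmetricType R}.
Implicit Types (v : X -> R) (mu nu : probability (borelType X) R).

Lemma meanD mu f g : bcont f -> bcont g ->
  mean (fun x => f x + g x) mu = mean f mu + mean g mu.
Proof. by move=> bf bg; rewrite /mean RintegralD//; exact: bcont_integrable. Qed.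

Lemma meanZ mu r f : bcont f -> mean (fun x => r * f x) mu = r * mean f mu.
Proof. by move=> bf; rewrite /mean RintegralZl//; exact: bcont_integrable. Qed.

Lemma mean_le mu f g : bcont f -> bcont g -> (forall x, f x <= g x) ->
  mean f mu <= mean g mu.
Proof. by move=> bf bg fg; apply: le_Rintegral => //; exact: bcont_integrable. Qed.

Lemma mean_cst mu (r : R) : mean (fun=> r) mu = r.
Proof. exact: Rintegral_probability_cst. Qed.

(** The bound is uniform in [mu], as [ultra_bounded_cvg] requires. *)
Lemma mean_bounded f : bcont f -> exists M : R, forall mu, `|mean f mu| <= M.
Proof.
move=> bf; have [_ [M fM]] := bf; exists M => mu; rewrite ler_norml.
apply/andP; split; [rewrite -[leLHS](mean_cst mu)|rewrite -[leRHS](mean_cst mu)].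
  by apply: mean_le => [||x]//; [exact: bcont_cst|
    have := fM x; rewrite ler_norml => /andP[]].
by apply: mean_le => [||x]//; [exact: bcont_cst|
    have := fM x; rewrite ler_norml => /andP[]].
Qed.

(** Integrate the pointwise bound of [f] by [e] plus [M] times the indicator of the complement of
    [K]. *)
Lemma mean_le_compact mu (K : set X) (f : X -> R) (M e : R) : compact K ->
  bcont f -> 0 <= M -> 0 <= e -> (forall x, 0 <= f x <= M) ->
  (forall x, K x -> f x <= e) ->
  ((mean f mu)%:E <= e%:E + M%:E * mu (~` K))%E.
Proof.
move=> cK bf M0 e0 f0M fe.
have mK : measurable (~` K : set (borelType X)).
  apply: measurable_open; apply: closed_openC; apply: compact_closed => //.
  exact: metric_hausdorff.
rewrite /mean /Rintegral fineK; last exact: integrable_fin_num (bcont_integrable mu bf).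
have -> : (e%:E + M%:E * mu (~` K) =
    \int[mu]_(x in [set: borelType X]) (e%:E + M%:E * (\1_(~` K) x)%:E))%E.
  rewrite ge0_integralD//; last first.
  - by apply/measurable_EFinP; apply: measurable_funM => //; exact: measurable_indic.
  - by move=> x _; rewrite mule_ge0// lee_fin.
  rewrite ge0_integralZl//; last exact/measurable_EFinP/measurable_indic.
  rewrite integral_indic// setIT integral_cst//.
  congr (_ + _)%E; rewrite -[LHS]mule1; congr (_ * _)%E.
  exact: esym (probability_setT mu).
apply: ge0_le_integral => //.
- by move=> x _; rewrite lee_fin; have /andP[] := f0M x.
- by apply/measurable_EFinP; exact: continuous_measurable bf.1.
- apply/measurable_EFinP; apply: measurable_funD => //.
  by apply: measurable_funM => //; exact: measurable_indic.
move=> x _; rewrite lee_fin indicE; have /andP[_ fM] := f0M x.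
have [Kx|Kx] := pselect (K x); last by rewrite mem_set//= mulr1 ler_wpDl.
by rewrite memNset ?mulr0 ?addr0 ?fe//; apply.
Qed.

Context (F : set_system (Pspace X)) (FU : UltraFilter F).
Context (tight : forall e : R, 0 < e -> exists2 K : set X, compact K &
  \forall mu \near F, ((mu : probability (borelType X) R) (~` K) <= e%:E)%E).

(** The value is a genuine limit for [bcont] functions, by [ulimP]; the laws of a Daniell functional
    concern only these. *)
Let ulim v : R := lim (mean v @ F).

Let ulimP v : bcont v -> mean v @ F --> ulim v.
Proof. by move=> /mean_bounded[M vM]; exact: ultra_bounded_cvg vM. Qed.

Let FF : ProperFilter F := ultra_proper.

Let ulimD f g : bcont f -> bcont g -> ulim (fun x => f x + g x) = ulim f + ulim g.
Proof.
move=> bf bg; apply/cvg_lim => //.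
rewrite (_ : mean _ = (fun mu => mean f mu + mean g mu)).
  by apply: cvgD; exact: ulimP.
by apply/funext => mu; exact: meanD.
Qed.

Let ulimZ r f : bcont f -> ulim (fun x => r * f x) = r * ulim f.
Proof.
move=> bf; apply/cvg_lim => //.
rewrite (_ : mean _ = (fun mu => r * mean f mu)).
  by apply: cvgM; [exact: cvg_cst|exact: ulimP].
by apply/funext => mu; exact: meanZ.
Qed.

Let ulim_ge0 f : bcont f -> (forall x, 0 <= f x) -> 0 <= ulim f.
Proof.
move=> bf f0; apply: limr_ge; first exact: ulimP.
by apply: nearW => mu; exact: Rintegral_ge0.
Qed.

Let ulim1 : ulim (fun=> 1) = 1.
Proof.
apply/cvg_lim => //; rewrite (_ : mean _ = fun=> 1); first exact: cvg_cst.
by apply/funext => mu; exact: mean_cst.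
Qed.

(** Tightness gives a compact set off which the contribution is at most e/2, and on it Dini's
    theorem puts h n below e/2. *)
Let ulim_cvg0 (h : nat -> X -> R) : (forall n, bcont (h n)) ->
  (forall x m n, (m <= n)%N -> h n x <= h m x) ->
  (forall x, h n x @[n --> \oo] --> 0) -> ulim (h n) @[n --> \oo] --> 0.
Proof.
move=> bh hn h0.
have h_ge0 n x : 0 <= h n x.
  have <- := cvg_lim (@Rhausdorff R) (h0 x).
  apply: (@nonincreasing_cvgn_ge _ (h ^~ x)); last by apply/cvg_ex; exists 0.
  by move=> m k; exact: hn.
have [_ [M hM]] := bh 0%N.
have M0 : 0 <= M by rewrite (le_trans _ (hM point)).
apply/cvgrPdist_le => e e0.
have e2 : 0 < e / 2 by rewrite divr_gt0.
(* [M] may be 0, hence the divisor [M + 1]. *)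
have eM : 0 < e / 2 / (M + 1) by rewrite divr_gt0// ltr_wpDl.
have [K cK FK] := tight eM.
have ch n : continuous (h n) by have [] := bh n.
near=> n.
rewrite sub0r normrN ger0_norm; last exact: ulim_ge0.
apply: limr_le; first exact: ulimP.
apply: filterS FK => mu muK; rewrite -lee_fin.
apply: (le_trans (mean_le_compact mu cK (bh n) M0 (ltW e2) _ _)).
- move=> x; rewrite h_ge0/= (le_trans (hn x 0%N n _))//.
  by rewrite (le_trans (ler_norm _)).
- move=> x Kx; apply/ltW; move: x Kx; near: n; exact: dini cK ch hn h0 e2.
rewrite [in leRHS](splitr e) EFinD leeD2l//.
apply: (@le_trans _ _ (M%:E * (e / 2 / (M + 1))%:E)%E).
  by rewrite lee_wpmul2l// lee_fin.
by rewrite lee_fin mulrCA ler_piMr ?(ltW e2)// ler_pdivrMr ?mul1r ?lerDl// ltr_wpDl.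
Unshelve. all: by end_near. Qed.

Lemma prokhorov_ultra : exists nu : probability (borelType X) R,
  forall v, bcont v -> mean v @ F --> mean v nu.
Proof.
pose L := DaniellFunctional ulimD ulimZ ulim_ge0 ulim1 ulim_cvg0.
exists (daniell_measure L) => v bv.
by rewrite [mean v (daniell_measure L)]daniell_integral//; exact: ulimP.
Qed.

End ultrafilter_of_probabilities.

(** * Moments *)

Section moments.
Context {R : realType} {X : pmetricType R}.
Implicit Types (f : X -> R) (mu nu : probability (borelType X) R).

Lemma measurable_EFin_continuous f : continuous f ->
  measurable_fun [set: borelType X] (fun x : borelType X => (f x)%:E).
Proof. by move=> cf; apply/measurable_EFinP; exact: continuous_measurable. Qed.

Lemma truncation_bcont f (t : R) : continuous f -> (forall x, 0 <= f x) -> 0 <= t ->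
  bcont (fun x => Num.min (f x) t).
Proof.
move=> cf f0 t0; split=> [x|].
  by apply: (@continuous_min R X f (fun=> t) x); [exact: cf|exact: cvg_cst].
by exists t => x; rewrite ger0_norm ?ge_min ?lexx ?orbT// le_min f0.
Qed.

Lemma EFin_mean mu f : bcont f ->
  (mean f mu)%:E = (\int[mu]_(x in [set: borelType X]) (f x)%:E)%E.
Proof.
move=> bf; rewrite /mean /Rintegral fineK//.
exact: integrable_fin_num (bcont_integrable mu bf).
Qed.

(** Markov's inequality: [t] times the indicator of f > t is at most [f]. *)
Lemma chebyshev_tail mu f (t b : R) : continuous f -> (forall x, 0 <= f x) -> 0 < t ->
  (\int[mu]_(x in [set: borelType X]) (f x)%:E <= b%:E)%E ->
  (mu (~` [set x | (f x <= t)%R]) <= (b / t)%:E)%E.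
Proof.
move=> cf f0 t0 fb; set A := ~` _.
have mA : measurable (A : set (borelType X)).
  apply: measurable_open; rewrite (_ : A = f @^-1` `]t, +oo[).
    by apply: open_comp => [x _|]; [exact: cf|exact: interval_open].
  by apply/seteqP; split=> x /=; rewrite in_itv/= andbT ltNge => /negP.
rewrite mulrC EFinM lee_pdivlMl//.
apply: le_trans fb; rewrite -[A]setIT -integral_indic// -ge0_integralZl//; last 2 first.
- exact/measurable_EFinP/measurable_indic.
- by rewrite lee_fin ltW.
apply: ge0_le_integral => //.
- by move=> x _; rewrite mule_ge0// lee_fin ltW.
- by apply/measurable_EFinP; apply: measurable_funM => //; exact: measurable_indic.
- exact: measurable_EFin_continuous.
move=> x _; rewrite lee_fin indicE; have [/set_mem Ax|] := boolP (x \in A).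
  by rewrite mulr1 leNgt; apply/negP => /ltW.
by rewrite mulr0.
Qed.

Context (F : set_system (Pspace X)) (FF : ProperFilter F).
Context (nu : probability (borelType X) R).
Context (Fnu : forall f, bcont f -> mean f @ F --> mean f nu).

(** The truncations min(f, n) are bounded and continuous, so their integrals keep the bound in the
    limit; monotone convergence then lets n grow. *)
Lemma limit_integral_le f (C : R) : continuous f -> (forall x, 0 <= f x) ->
  (\forall mu \near F,
    (\int[mu : probability (borelType X) R]_(x in [set: borelType X]) (f x)%:E <= C%:E)%E) ->
  (\int[nu]_(x in [set: borelType X]) (f x)%:E <= C%:E)%E.
Proof.
move=> cf f0 fC.
pose g (n : nat) (x : borelType X) := (Num.min (f x) n%:R)%:E.
have bg n : bcont (fun x => Num.min (f x) n%:R) by exact: truncation_bcont.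
have mg n : measurable_fun [set: borelType X] (g n).
  by apply: measurable_EFin_continuous; have [] := bg n.
have g0 n x : [set: borelType X] x -> (0 <= g n x)%E by rewrite lee_fin le_min f0/=.
have ndg x : [set: borelType X] x -> {homo g^~ x : n m / (n <= m)%N >-> (n <= m)%E}.
  by move=> _ n m nm; rewrite lee_fin le_min ge_min lexx/= ge_min ler_nat nm orbT.
have := @cvg_monotone_convergence _ _ _ nu _ measurableT _ mg g0 ndg.
have -> : (\int[nu]_(x in [set: borelType X]) limn (g^~ x) =
           \int[nu]_(x in [set: borelType X]) (f x)%:E)%E.
  apply: eq_integral => x _; apply/cvg_lim => //; apply: cvg_near_cst.
  near=> n; congr EFin; apply/min_idPl; near: n; exact: nbhs_infty_ger.
move=> /cvg_lim <-//.
apply: lime_le.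
  apply: ereal_nondecreasing_is_cvgn => n m nm.
  by apply: ge0_le_integral => // x xT; [exact: g0|exact: ndg].
apply: nearW => n; rewrite -EFin_mean// lee_fin.
rewrite -(cvg_lim (@Rhausdorff R) (Fnu (bg n))).
apply: limr_le.
  by apply/cvg_ex; exists (mean (fun x => Num.min (f x) n%:R) nu); exact: Fnu.
apply: filterS fC => mu; rewrite -lee_fin; apply: le_trans.
rewrite EFin_mean//; apply: ge0_le_integral => //.
- by move=> x _; exact: (g0 n).
- exact: (mg n).
- exact: measurable_EFin_continuous.
- by move=> x _; rewrite lee_fin ge_min lexx.
Unshelve. all: by end_near. Qed.

(** One truncation level costs at most [e] eventually along [F]; the truncated mean passes to the
    limit and lies below the integral of [f]. *)
Lemma limit_integral_ge f (C : R) : continuous f -> (forall x, 0 <= f x) ->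
  (forall e : R, 0 < e -> exists2 t : R, 0 <= t &
    \forall mu \near F, C - e <= mean (fun x => Num.min (f x) t) mu) ->
  (C%:E <= \int[nu]_(x in [set: borelType X]) (f x)%:E)%E.
Proof.
move=> cf f0 fC; apply/lee_addgt0Pr => e e0; have [t t0 Ft] := fC e e0.
have bt := truncation_bcont cf f0 t0.
rewrite -leeBlDr// -EFinB (@le_trans _ _ (mean (fun x => Num.min (f x) t) nu)%:E)//.
  rewrite lee_fin -(cvg_lim (@Rhausdorff R) (Fnu bt)).
  apply: limr_ge => //.
  by apply/cvg_ex; exists (mean (fun x => Num.min (f x) t) nu); exact: Fnu.
rewrite EFin_mean//; apply: ge0_le_integral => //.
- by move=> x _; rewrite lee_fin le_min f0.
- by apply: measurable_EFin_continuous; have [] := bt.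
- exact: measurable_EFin_continuous.
- by move=> x _; rewrite lee_fin ge_min lexx.
Qed.

End moments.

(** * Real powers and truncation *)

Section power_moments.
Context {R : realType}.

(** Both the power [p] and its inverse, the power 1/p, are strictly increasing, so bounds on f^p
    translate into bounds on [f]. *)
Lemma powR_continuous (X : topologicalType) (f : X -> R) (p : R) : 0 < p ->
  continuous f -> (forall x, 0 <= f x) -> continuous (fun x => f x `^ p).
Proof.
move=> p0 cf f0 x; apply/cvgrPdist_lt => e e0; set u := f x `^ p.
have u0 : 0 <= u by exact: powR_ge0.
have rootK s : 0 <= s -> (s `^ p^-1) `^ p = s.
  by move=> s0; rewrite -powRrM mulVf ?gt_eqF// powRr1.
have fu : f x = u `^ p^-1 by rewrite -powRrM mulfV ?gt_eqF// powRr1.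
have lt_root s t : 0 <= s -> 0 <= t -> s < t -> s `^ p^-1 < t `^ p^-1.
  by move=> s0 t0; apply: gt0_ltr_powR; rewrite ?invr_gt0 ?nnegrE.
have lt_pow s t : 0 <= s -> 0 <= t -> s < t -> s `^ p < t `^ p.
  by move=> s0 t0; apply: gt0_ltr_powR; rewrite ?nnegrE.
have ue0 : 0 <= u + e by rewrite addr_ge0// ltW.
have : f x < (u + e) `^ p^-1 by rewrite fu lt_root// ltrDl.
move=> /(cvgr_lt _ (cf x)) near_lt.
have near_gt : \forall y \near x, u - e < f y `^ p.
  (* A negative lower bound has no root to compare with, but any power exceeds it. *)
  have [ue|ue] := ltP (u - e) 0.
    by apply: nearW => y; rewrite (lt_le_trans ue)// powR_ge0.
  have : (u - e) `^ p^-1 < f x by rewrite fu lt_root// ltrBlDr ltrDl.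
  move=> /(cvgr_gt _ (cf x)); apply: filterS => y uy.
  by rewrite -(rootK _ ue) lt_pow// powR_ge0.
near=> y; rewrite ltr_norml; apply/andP; split; last first.
  by rewrite ltrBlDr -ltrBlDl; near: y.
rewrite ltrBrDr addrC ltrBlDr -(rootK _ ue0) lt_pow ?powR_ge0//; near: y; exact: near_lt.
Unshelve. all: by end_near. Qed.

(** If y > t, then y^(1+r) = y y^r >= y t^r. *)
Lemma truncation_defect (y t r : R) : 0 <= y -> 0 < t -> 0 < r ->
  y <= Num.min y t + (t `^ r)^-1 * y `^ (1 + r).
Proof.
move=> y0 t0 r0; have [yt|ty] := leP y t.
  by rewrite lerDl mulr_ge0 ?powR_ge0// invr_ge0 powR_ge0.
rewrite (@le_trans _ _ ((t `^ r)^-1 * y `^ (1 + r)))//; last by rewrite lerDr ltW.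
rewrite ler_pdivlMl ?powR_gt0// powRD; last by rewrite gt_eqF// addr_gt0.
by rewrite powRr1// mulrC ler_wpM2l// ge0_ler_powR// ?nnegrE ltW.
Qed.

End power_moments.

(** * Compactness under the moment constraints *)

Section moment_constraints.
Context {R : realType} {X : pmetricType R} (x0 : X) (a b r c : R).
Context (r0 : 0 < r) (c0 : 0 < c).
Implicit Types mu : probability (borelType X) R.

Let d (x : X) : R := mdist x x0.
Let d0 x : 0 <= d x. Proof. exact: mdist_ge0. Qed.
Let cd : continuous d. Proof. exact: continuous_mdist. Qed.
Let p0 : 0 < 1 + r. Proof. by rewrite addr_gt0. Qed.
Let cdp : continuous (fun x => d x `^ (1 + r)).
Proof. exact: powR_continuous. Qed.

(** Integrating [truncation_defect] costs at most c / t^r, which is [e] when t^r = c / e; this level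
    is the same for all measures of the set. *)
Lemma truncated_mean_ge mu (e : R) : 0 < e -> Pab_rc x0 a b r c mu ->
  a - e <= mean (fun x => Num.min (d x) ((c / e) `^ r^-1)) mu.
Proof.
move=> e0 [/andP[ad _] dc]; set t := (c / e) `^ r^-1.
have ce0 : 0 < c / e by rewrite divr_gt0.
have t0 : 0 < t by rewrite powR_gt0.
have tr : t `^ r = c / e by rewrite -powRrM mulVf ?gt_eqF// powRr1// ltW.
have bt := truncation_bcont cd d0 (ltW t0).
rewrite lerBlDr -lee_fin (le_trans ad)// EFinD EFin_mean//.
have k0 : 0 <= (c / e)^-1 by rewrite invr_ge0 ltW.
have md := measurable_EFin_continuous cd.
have mt := measurable_EFin_continuous bt.1.
have mp := measurable_EFin_continuous cdp.
have mkp : measurable_fun [set: borelType X]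
    (fun x : borelType X => (c / e)^-1%:E * (d x `^ (1 + r))%:E)%E.
  exact: measurable_funeM.
apply: (@le_trans _ _ (\int[mu]_(x in [set: borelType X])
    ((Num.min (d x) t)%:E + (c / e)^-1%:E * (d x `^ (1 + r))%:E))%E).
  apply: ge0_le_integral => //.
  - by move=> x _; rewrite lee_fin mdist_ge0.
  - exact: emeasurable_funD.
  - by move=> x _; rewrite -EFinM -EFinD lee_fin -tr; exact: truncation_defect (d0 x) t0 r0.
rewrite ge0_integralD//; last 2 first.
- by move=> x _; rewrite lee_fin le_min d0 ltW.
- by move=> x _; rewrite mule_ge0// lee_fin powR_ge0.
rewrite leeD2l// ge0_integralZl//; last first.
  by move=> x _; rewrite lee_fin powR_ge0.
apply: (@le_trans _ _ ((c / e)^-1%:E * c%:E)%E).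
  by rewrite lee_wpmul2l// lee_fin.
by rewrite lee_fin invf_div divfK// gt_eqF.
Qed.

Lemma Pab_rc_compact : heine_borel_space X -> 0 < b ->
  @compact (Pspace X) (Pab_rc x0 a b r c).
Proof.
move=> hX b0; rewrite compact_ultra => F FU FA.
have tight e : 0 < e -> exists2 K : set X, compact K &
    \forall mu \near F, ((mu : probability (borelType X) R) (~` K) <= e%:E)%E.
  (* With radius b / e the tail bound is b / (b / e) = e. *)
  move=> e0; exists [set x | d x <= b / e].
    apply: hX.
      rewrite (_ : [set _ | _] = d @^-1` `]-oo, b / e]).
        by apply: preimage_closed => [x _|]; [exact: cd|exact: interval_closed].
      by apply/seteqP; split=> x /=; rewrite in_itv.
    exists (b / e + b / e) => x y dx dy.
    by rewrite (le_trans (metric_triangle x x0 y))// lerD// metric_sym.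
  apply: filterS FA => mu [/andP[_ db] _].
  have be0 : 0 < b / e by rewrite divr_gt0.
  apply: le_trans (chebyshev_tail cd d0 be0 db) _.
  by rewrite lee_fin invf_div mulrCA mulfV ?gt_eqF// mulr1.
have [nu Fnu] := prokhorov_ultra FU tight.
have FF := @ultra_proper _ _ FU.
exists nu; split; last exact: weak_cvg.
split; last first.
  have dp0 x : 0 <= d x `^ (1 + r) by exact: powR_ge0.
  apply: (limit_integral_le FF Fnu cdp dp0).
  by apply: filterS FA => mu [].
apply/andP; split; last first.
  by apply: (limit_integral_le FF Fnu cd d0); apply: filterS FA => mu [/andP[]].
apply: (limit_integral_ge FF Fnu cd d0) => e e0.
exists ((c / e) `^ r^-1); first exact: powR_ge0.
by apply: filterS FA => mu; exact: truncated_mean_ge.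
Qed.

End moment_constraints.

Theorem theorem6 (R : realType) (X : pmetricType R) (x0 : X) (a b r c : R)
    (hX : heine_borel_space X) (ha : 0 < a) (hab : a < b)
    (hr : 0 < r) (hc : 0 < c) :
  @compact (Pspace X) (Pab_rc x0 a b r c) /\
  @sigma_compact (Pspace X) (Pab_r x0 a b r).
Proof.
have b0 : 0 < b by exact: lt_trans hab.
split; first exact: Pab_rc_compact.
(* The successor keeps the moment bound positive, as compactness requires. *)
exists (fun n => Pab_rc x0 a b r n.+1%:R) => [n|]; first exact: Pab_rc_compact.
apply/seteqP; split=> [mu [ab fin]|mu [n _ [ab le]]]; last first.
  by split=> //; rewrite (le_lt_trans le)// ltry.
have m0 : (0 <= moment x0 (1 + r) mu)%E.
  by apply: integral_ge0 => x _; rewrite lee_fin powR_ge0.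
exists (Num.truncn (fine (moment x0 (1 + r) mu))) => //; split=> //.
rewrite -(@fineK _ (moment x0 (1 + r) mu)) ?ge0_fin_numE// lee_fin.
exact/ltW/truncnS_gt.
Qed.
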